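(* Let $\{(x_i,y_i): i=1,2,\dots,N\}$ be a set of monotonic data, let $S$ be the rational cubic spline FIF for these data with derivative parameters $d_i$, scaling factors $\alpha_i$ and shape parameters $r_i$, and assume that the necessary conditions on the derivative parameters hold: $d_i\ge0$ for all $i$ if the data are monotonic increasing, $d_i\le0$ for all $i$ if the data are monotonic decreasing. Then the following conditions on the scaling factors and the shape parameters for every $i\in J$ are sufficient for $S$ to be monotonic on $I=[x_1,x_N]$: $$0\le\alpha_i\le\min\Big\{\kappa a_i,\ \frac{d_ia_i}{d_1},\ \frac{d_{i+1}a_i}{d_N},\ \kappa^*\frac{\Delta_ih_i}{y_N-y_1}\Big\},\qquad \kappa,\kappa^*\in[0,1),$$ $$r_i\ge\frac{h_i(d_i+d_{i+1})-\alpha_i(x_N-x_1)(d_1+d_N)}{h_i\Delta_i-\alpha_i(y_N-y_1)}.$$ In particular, if $$r_i=1+\frac{h_i(d_i+d_{i+1})-\alpha_i(x_N-x_1)(d_1+d_N)}{h_i\Delta_i-\alpha_i(y_N-y_1)},\qquad i\in J,$$ then $S$ reduces to the rational quadratic spline FIF given by $$S(L_i(x))=\alpha_iS(x)+\frac{\hat P_i(\theta)}{\hat Q_i(\theta)},\qquad \theta=\frac{x-x_1}{x_N-x_1},\ x\in I,\ i\in J,$$ with $$\begin{aligned}\hat P_i(\theta)={}&(y_{i+1}-\alpha_iy_N)\Delta_i\theta^2+\beta_i\Big\{(y_id_{i+1}+y_{i+1}d_i)a_i-\alpha_i\big[y_{i+1}d_1+y_id_N+a_i(y_Nd_i+y_1d_{i+1})\big]\\&+\alpha_i^2(y_Nd_1+y_1d_N)\Big\}\theta(1-\theta)+(y_i-\alpha_iy_1)\Delta_i(1-\theta)^2,\\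 \hat Q_i(\theta)={}&\Delta_i\theta^2+\beta_i\big[a_i(d_i+d_{i+1})-\alpha_i(d_1+d_N)\big]\theta(1-\theta)+\Delta_i(1-\theta)^2,\\ \beta_i={}&\frac{\Delta_i(x_N-x_1)}{(y_{i+1}-y_i)-\alpha_i(y_N-y_1)},\end{aligned}$$ and in this case the conditions $$0\le\alpha_i\le\min\Big\{\kappa a_i,\ \frac{d_ia_i}{d_1},\ \frac{d_{i+1}a_i}{d_N},\ \kappa^*\frac{\Delta_ih_i}{y_N-y_1}\Big\},\qquad i\in J,\ \kappa,\kappa^*\in[0,1),$$ on the $\alpha_i$ alone are sufficient for $S$ to be monotonic on $I$.
   Context: Let $N\ge2$, $x_1<x_2<\dots<x_N$, $I=[x_1,x_N]$, $J=\{1,\dots,N-1\}$, $h_i=x_{i+1}-x_i$, $a_i=h_i/(x_N-x_1)$, $\Delta_i=(y_{i+1}-y_i)/h_i$, and let $L_i(x)=a_ix+b_i$ be the affine map with $L_i(x_1)=x_i$, $L_i(x_N)=x_{i+1}$. The data are monotonic increasing if $y_1\le y_2\le\dots\le y_N$, and monotonic decreasing if the inequalities are reversed. Given values $y_i$, derivative parameters $d_i$ ($i=1,\dots,N$), scaling factors $\alpha_i$ with $|\alpha_i|\le\kappa a_i$ ($i\in J$, $0\le\kappa<1$) and shape parameters $r_i>-1$ ($i\in J$), the rational cubic spline FIF is the unique function $S\in\mathcal{C}^1(I)$ satisfying, with $\theta=\frac{x-x_1}{x_N-x_1}$, $$S(L_i(x))=\alpha_iS(x)+\frac{P_i(\theta)}{Q_i(\theta)},\quad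 x\in I,\ i\in J,\qquad Q_i(\theta)=1+(r_i-3)\theta(1-\theta),$$ $$\begin{aligned}P_i(\theta)={}&(y_i-\alpha_iy_1)(1-\theta)^3+\{[r_iy_i+h_id_i]-\alpha_i[r_iy_1+d_1(x_N-x_1)]\}\theta(1-\theta)^2\\&+\{[r_iy_{i+1}-h_id_{i+1}]-\alpha_i[r_iy_N-d_N(x_N-x_1)]\}\theta^2(1-\theta)+(y_{i+1}-\alpha_iy_N)\theta^3.\end{aligned}$$ It satisfies $S(x_i)=y_i$ and $S^{(1)}(x_i)=d_i$ for all $i$. Conventions for vanishing denominators: if $d_1=0$ (respectively $d_N=0$), the term $d_ia_i/d_1$ (respectively $d_{i+1}a_i/d_N$) is omitted from the minimum. If $\Delta_i=0$ for some $i\in J$, then one takes $\alpha_i=0$ and $d_i=d_{i+1}=0$, the conditions on $r_i$ (other than $r_i>-1$) are void for that $i$, and $S(L_i(x))=y_i=y_{i+1}$ for $x\in I$ (this also replaces the rational quadratic formula on that subinterval). *)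

(* Defs.v *)
From Stdlib Require Import Reals List RList.
Import ListNotations.
Open Scope R_scope.

(** Data are sequences [nat -> R] of which only the entries [1, ..., N] matter;
    [J] is the range [1 <= i < N]. *)

Definition interval (N : nat) (x : nat -> R) (t : R) : Prop :=
  x 1%nat <= t <= x N.

Definition h (x : nat -> R) (i : nat) : R := x (i + 1)%nat - x i.

Definition a (N : nat) (x : nat -> R) (i : nat) : R :=
  h x i / (x N - x 1%nat).

Definition slope (x y : nat -> R) (i : nat) : R :=
  (y (i + 1)%nat - y i) / h x i.

(** The intercept is the one forced by [L_i(x_1) = x_i]; then
    [L_i(x_N) = x_{i+1}] by the value of [a]. *)
Definition L (N : nat) (x : nat -> R) (i : nat) (t : R) : R :=
  a N x i * t + (x i - a N x i * x 1%nat).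

Definition theta (N : nat) (x : nat -> R) (t : R) : R :=
  (t - x 1%nat) / (x N - x 1%nat).

Definition increasing_data (N : nat) (y : nat -> R) : Prop :=
  forall i, (1 <= i < N)%nat -> y i <= y (i + 1)%nat.

Definition decreasing_data (N : nat) (y : nat -> R) : Prop :=
  forall i, (1 <= i < N)%nat -> y (i + 1)%nat <= y i.

Definition nondecreasing_on (D : R -> Prop) (f : R -> R) : Prop :=
  forall u v, D u -> D v -> u <= v -> f u <= f v.

Definition nonincreasing_on (D : R -> Prop) (f : R -> R) : Prop :=
  forall u v, D u -> D v -> u <= v -> f v <= f u.

(** Monotonic on the interval, in the direction of the data. *)
Definition monotonic_as_data (N : nat) (x y : nat -> R) (s : R -> R) : Prop :=
  (increasing_data N y -> nondecreasing_on (interval N x) s) /\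
  (decreasing_data N y -> nonincreasing_on (interval N x) s).

(** The limits in [D_in] and [continue_in] are taken within [D], so at an
    endpoint of an interval they are one-sided. *)
Definition C1_on (D : R -> Prop) (f : R -> R) : Prop :=
  exists f' : R -> R, forall t, D t -> D_in f f' D t /\ continue_in f' D t.

Definition Q (r : nat -> R) (i : nat) (t : R) : R :=
  1 + (r i - 3) * t * (1 - t).

Definition P (N : nat) (x y d alpha r : nat -> R) (i : nat) (t : R) : R :=
  (y i - alpha i * y 1%nat) * (1 - t) ^ 3
  + ((r i * y i + h x i * d i)
     - alpha i * (r i * y 1%nat + d 1%nat * (x N - x 1%nat)))
    * t * (1 - t) ^ 2
  + ((r i * y (i + 1)%nat - h x i * d (i + 1)%nat)
     - alpha i * (r i * y N - d N * (x N - x 1%nat)))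
    * t ^ 2 * (1 - t)
  + (y (i + 1)%nat - alpha i * y N) * t ^ 3.

(** Only the restriction of [s] to the interval is constrained. *)
Definition rational_cubic_FIF
    (N : nat) (x y d alpha r : nat -> R) (s : R -> R) : Prop :=
  C1_on (interval N x) s /\
  forall i, (1 <= i < N)%nat -> forall t, interval N x t ->
    s (L N x i t) =
      alpha i * s t
      + P N x y d alpha r i (theta N x t) / Q r i (theta N x t).

Definition flat_convention (N : nat) (x y d alpha : nat -> R) : Prop :=
  forall i, (1 <= i < N)%nat -> slope x y i = 0 ->
    alpha i = 0 /\ d i = 0 /\ d (i + 1)%nat = 0.

(** [num / den], as a term of a minimum that is omitted when [den = 0]. *)
Definition quotient_term (num den : R) : list R :=
  if Req_dec_T den 0 then [] else [num / den].

(** If [y N = y 1] for monotonic data, then every [slope x y i] vanishes, hence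
    so does the last term, whatever the value of [/ 0]; under
    [flat_convention], [alpha i = 0] then meets the condition. *)
Definition scaling_condition
    (N : nat) (x y d alpha : nat -> R) (kappa kappa_star : R) : Prop :=
  forall i, (1 <= i < N)%nat ->
    0 <= alpha i <=
      MinRlist ([kappa * a N x i]
                ++ quotient_term (d i * a N x i) (d 1%nat)
                ++ quotient_term (d (i + 1)%nat * a N x i) (d N)
                ++ [kappa_star * (slope x y i * h x i / (y N - y 1%nat))]).

Definition shape_den (N : nat) (x y alpha : nat -> R) (i : nat) : R :=
  h x i * slope x y i - alpha i * (y N - y 1%nat).

Definition shape_quotient (N : nat) (x y d alpha : nat -> R) (i : nat) : R :=
  (h x i * (d i + d (i + 1)%nat)
   - alpha i * (x N - x 1%nat) * (d 1%nat + d N))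
  / shape_den N x y alpha i.

Definition shape_condition (N : nat) (x y d alpha r : nat -> R) : Prop :=
  forall i, (1 <= i < N)%nat -> slope x y i <> 0 ->
    r i >= shape_quotient N x y d alpha i.

Definition quadratic_shape (N : nat) (x y d alpha r : nat -> R) : Prop :=
  forall i, (1 <= i < N)%nat -> slope x y i <> 0 ->
    r i = 1 + shape_quotient N x y d alpha i.

Definition beta (N : nat) (x y alpha : nat -> R) (i : nat) : R :=
  slope x y i * (x N - x 1%nat)
  / ((y (i + 1)%nat - y i) - alpha i * (y N - y 1%nat)).

Definition Phat (N : nat) (x y d alpha : nat -> R) (i : nat) (t : R) : R :=
  (y (i + 1)%nat - alpha i * y N) * slope x y i * t ^ 2
  + beta N x y alpha i
    * ((y i * d (i + 1)%nat + y (i + 1)%nat * d i) * a N x i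
       - alpha i * (y (i + 1)%nat * d 1%nat + y i * d N
                    + a N x i * (y N * d i + y 1%nat * d (i + 1)%nat))
       + alpha i ^ 2 * (y N * d 1%nat + y 1%nat * d N))
    * t * (1 - t)
  + (y i - alpha i * y 1%nat) * slope x y i * (1 - t) ^ 2.

Definition Qhat (N : nat) (x y d alpha : nat -> R) (i : nat) (t : R) : R :=
  slope x y i * t ^ 2
  + beta N x y alpha i
    * (a N x i * (d i + d (i + 1)%nat) - alpha i * (d 1%nat + d N))
    * t * (1 - t)
  + slope x y i * (1 - t) ^ 2.

(** On a subinterval where the data are flat, the rational quadratic formula
    (whose denominator is then [0]) is replaced by the constant value. *)
Definition rational_quadratic_form
    (N : nat) (x y d alpha : nat -> R) (s : R -> R) : Prop :=
  forall i, (1 <= i < N)%nat -> forall t, interval N x t ->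
    (slope x y i <> 0 ->
       s (L N x i t) =
         alpha i * s t
         + Phat N x y d alpha i (theta N x t)
           / Qhat N x y d alpha i (theta N x t)) /\
    (slope x y i = 0 -> s (L N x i t) = y i /\ y i = y (i + 1)%nat).

(* Main.v *)
(** Put [R_i = P_i / Q_i]. The conditions make every [R_i] nondecreasing on
    [[0, 1]] (for increasing data), so [S o L_i - alpha_i S] is nondecreasing.
    As [S] is [C^1] on a compact interval, [S(t) + K t] is nondecreasing for
    some [K >= 0]. Since [0 <= alpha_i <= kappa a_i], the functional equation
    turns this [K] into [kappa K] on each [[x_i, x_{i+1}]], hence on the whole
    interval; iterating, [K] may be replaced by [0]. Decreasing data follow by
    negating [y], [d] and [S]. *)

Require Import Defs.
From Stdlib Require Import Reals List RList Lia Lra.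
From Coquelicot Require Import Coquelicot.
Open Scope R_scope.

(** * One-sided regularity on a compact interval *)

Definition clamp (lo hi t : R) : R := Rmax lo (Rmin hi t).

Lemma clamp_in (lo hi t : R) : lo <= hi -> lo <= clamp lo hi t <= hi.
Proof. unfold clamp, Rmax, Rmin; intros; repeat destruct Rle_dec; lra. Qed.

Lemma clamp_id (lo hi t : R) : lo <= t <= hi -> clamp lo hi t = t.
Proof. unfold clamp, Rmax, Rmin; intros; repeat destruct Rle_dec; lra. Qed.

Lemma clamp_contracting (lo hi t u : R) :
  Rabs (clamp lo hi u - clamp lo hi t) <= Rabs (u - t).
Proof.
  unfold clamp, Rmax, Rmin, Rabs; repeat destruct Rle_dec;
    repeat destruct Rcase_abs; lra.
Qed.

(** Composing with [clamp] extends [f] by its end values to the whole line, so the two-sided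
    theorems of the library apply; continuity survives because [clamp] is 1-Lipschitz. *)
Lemma continuity_pt_clamp (lo hi : R) (f : R -> R) (t : R) :
  lo <= hi ->
  (forall u, lo <= u <= hi -> continue_in f (fun w => lo <= w <= hi) u) ->
  continuity_pt (fun u => f (clamp lo hi u)) t.
Proof.
  intros Hlh Hf eps Heps.
  destruct (Hf _ (clamp_in lo hi t Hlh) eps Heps) as [del [Hdel H]].
  exists del; split; [exact Hdel|].
  intros u [_ Hu]; simpl in *; unfold Rdist in *.
  (* The limit in [continue_in] excludes its base point, so two arguments clamped to the same point
     form a case of their own. *)
  destruct (Req_dec (clamp lo hi t) (clamp lo hi u)) as [E|E].
  - rewrite E, Rminus_diag, Rabs_R0; exact Heps.
  - apply H; repeat split; try apply clamp_in; auto.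
    eapply Rle_lt_trans; [apply clamp_contracting | exact Hu].
Qed.

Lemma derivable_pt_lim_of_D_in (lo hi : R) (f f' : R -> R) (t : R) :
  lo < t < hi -> D_in f f' (fun u => lo <= u <= hi) t ->
  derivable_pt_lim (fun u => f (clamp lo hi u)) t (f' t).
Proof.
  intros Ht Hf eps Heps.
  destruct (Hf eps Heps) as [del [Hdel H]].
  assert (Hm : 0 < Rmin del (Rmin (t - lo) (hi - t)))
    by (repeat apply Rmin_glb_lt; lra).
  exists (mkposreal _ Hm); simpl; intros k Hk Hkm.
  pose proof (Rmin_l del (Rmin (t - lo) (hi - t))).
  pose proof (Rmin_r del (Rmin (t - lo) (hi - t))).
  pose proof (Rmin_l (t - lo) (hi - t)).
  pose proof (Rmin_r (t - lo) (hi - t)).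
  assert (Hb : - Rmin del (Rmin (t - lo) (hi - t)) < k
               < Rmin del (Rmin (t - lo) (hi - t)))
    by (apply Rabs_def2 in Hkm; lra).
  rewrite !clamp_id by lra.
  specialize (H (t + k)); simpl in H; unfold Rdist in H.
  replace (t + k - t) with k in H by ring.
  apply H; repeat split; lra.
Qed.

(** The continuous derivative attains its minimum on the compact interval; [K] is the negative part
    of that minimum, and the mean value theorem does the rest. *)
Lemma C1_add_linear_nondecreasing (lo hi : R) (f : R -> R) :
  lo <= hi -> C1_on (fun t => lo <= t <= hi) f ->
  exists K, 0 <= K /\
    nondecreasing_on (fun t => lo <= t <= hi) (fun t => f t + K * t).
Proof.
  intros Hlh [f' Hf].
  destruct (continuity_ab_min (fun u => f' (clamp lo hi u)) lo hi Hlh)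
    as [m [Hm _]].
  { intros c _; apply continuity_pt_clamp; [exact Hlh|].
    intros u Hu; apply Hf, Hu. }
  exists (Rmax 0 (- f' (clamp lo hi m))); split; [apply Rmax_l|].
  intros u v Hu Hv Huv.
  destruct (MVT_gen (fun t => f (clamp lo hi t)) u v f') as [c [Hc E]].
  - rewrite Rmin_left, Rmax_right by exact Huv; intros c Hc.
    apply is_derive_Reals, derivable_pt_lim_of_D_in; [lra|].
    apply Hf; lra.
  - intros c _; apply continuity_pt_clamp; [exact Hlh|].
    intros w Hw; apply cont_deriv with f', Hf, Hw.
  - rewrite Rmin_left, Rmax_right in Hc by exact Huv.
    rewrite !clamp_id in E by assumption.
    specialize (Hm c ltac:(lra)); simpl in Hm.
    rewrite (clamp_id lo hi c) in Hm by lra.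
    pose proof (Rmax_r 0 (- f' (clamp lo hi m))).
    nra.
Qed.

Lemma sequence_nondecreasing (N : nat) (y : nat -> R) :
  increasing_data N y ->
  forall i j, (1 <= i)%nat -> (i <= j <= N)%nat -> y i <= y j.
Proof.
  intros Hy i j Hi; induction j as [|j IH]; intros Hj; [lia|].
  destruct (Nat.eq_dec i (S j)) as [->|Hn]; [lra|].
  specialize (IH ltac:(lia)).
  specialize (Hy j ltac:(lia)); replace (j + 1)%nat with (S j) in Hy by lia.
  lra.
Qed.

(** * The partition, its affine maps, and monotonicity from self-similarity *)

Section Partition.

Variables (N : nat) (x : nat -> R).
Hypothesis hN : (2 <= N)%nat.
Hypothesis hx : forall i, (1 <= i < N)%nat -> x i < x (i + 1)%nat.

Lemma nodes_nondecreasing : increasing_data N x.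
Proof. intros i Hi; left; auto. Qed.

Lemma nodes_endpoints_lt : x 1%nat < x N.
Proof.
  pose proof (hx 1%nat ltac:(lia)).
  pose proof (sequence_nondecreasing N x nodes_nondecreasing (1 + 1) N
                ltac:(lia) ltac:(lia)).
  lra.
Qed.

Lemma h_pos (i : nat) : (1 <= i < N)%nat -> 0 < h x i.
Proof. intros Hi; unfold h; specialize (hx i Hi); lra. Qed.

Lemma h_eq (i : nat) : h x i = a N x i * (x N - x 1%nat).
Proof. pose proof nodes_endpoints_lt; unfold a; field; lra. Qed.

Lemma a_pos (i : nat) : (1 <= i < N)%nat -> 0 < a N x i.
Proof.
  intros Hi; pose proof nodes_endpoints_lt; pose proof (h_pos i Hi).
  apply Rdiv_lt_0_compat; lra.
Qed.

Lemma L_surjective (i : nat) (t : R) :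
  (1 <= i < N)%nat -> x i <= t <= x (i + 1)%nat ->
  exists t', interval N x t' /\ L N x i t' = t.
Proof.
  intros Hi Ht; pose proof (a_pos i Hi) as Ha; pose proof (h_eq i) as E.
  unfold h in E.
  exists (x 1%nat + (t - x i) / a N x i); unfold interval, L; split.
  - assert (Hq : (t - x i) / a N x i * a N x i = t - x i) by (field; lra).
    set (q := (t - x i) / a N x i) in *; split; nra.
  - field; lra.
Qed.

Lemma theta_in (t : R) : interval N x t -> 0 <= theta N x t <= 1.
Proof.
  intros Ht; pose proof nodes_endpoints_lt; unfold theta, interval in *.
  assert (E : (t - x 1%nat) / (x N - x 1%nat) * (x N - x 1%nat) = t - x 1%nat)
    by (field; lra).
  set (q := (t - x 1%nat) / (x N - x 1%nat)) in *; split; nra.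
Qed.

Lemma theta_le (t u : R) : t <= u -> theta N x t <= theta N x u.
Proof.
  intros Htu; pose proof nodes_endpoints_lt; unfold theta, Rdiv.
  apply Rmult_le_compat_r; [left; apply Rinv_0_lt_compat|]; lra.
Qed.

Lemma piecewise_nondecreasing (g : R -> R) :
  (forall i, (1 <= i < N)%nat ->
     nondecreasing_on (fun t => x i <= t <= x (i + 1)%nat) g) ->
  nondecreasing_on (interval N x) g.
Proof.
  intros Hg.
  enough (H : forall n, (1 <= n <= N)%nat -> nondecreasing_on (interval n x) g)
    by (apply H; lia).
  induction n as [|n IH]; intros Hn; [lia|].
  (* The base case is the degenerate interval consisting of the first node. *)
  destruct (Nat.eq_dec n 0) as [->|Hn0].
  { intros u v Hu Hv _; unfold interval in *.
    replace u with v by lra; lra. }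
  specialize (IH ltac:(lia)); specialize (Hg n ltac:(lia)).
  replace (n + 1)%nat with (S n) in Hg by lia.
  pose proof (sequence_nondecreasing N x nodes_nondecreasing 1 n
                ltac:(lia) ltac:(lia)).
  intros u v Hu Hv Huv; unfold interval in *.
  destruct (Rle_dec v (x n)); [apply IH; lra|].
  destruct (Rle_dec (x n) u); [apply Hg; lra|].
  apply Rle_trans with (g (x n)); [apply IH | apply Hg]; lra.
Qed.

(* Self-similarity improves a one-sided Lipschitz bound [K] to [kappa * K]. *)
Lemma self_similar_nondecreasing (alpha : nat -> R) (kappa : R) (s : R -> R) :
  0 <= kappa < 1 ->
  C1_on (interval N x) s ->
  (forall i, (1 <= i < N)%nat -> 0 <= alpha i <= kappa * a N x i) ->
  (forall i, (1 <= i < N)%nat -> forall u v, interval N x u -> interval N x v ->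
     u <= v -> alpha i * (s v - s u) <= s (L N x i v) - s (L N x i u)) ->
  nondecreasing_on (interval N x) s.
Proof.
  intros Hk HC1 Ha Hs.
  assert (Himp : forall K, 0 <= K ->
    nondecreasing_on (interval N x) (fun t => s t + K * t) ->
    nondecreasing_on (interval N x) (fun t => s t + kappa * K * t)).
  { intros K HK Hmono; apply piecewise_nondecreasing; intros i Hi u v Hu Hv Huv.
    destruct (L_surjective i u Hi Hu) as [u' [Hu' <-]].
    destruct (L_surjective i v Hi Hv) as [v' [Hv' <-]].
    pose proof (a_pos i Hi) as Hpos; destruct (Ha i Hi) as [H0 H1].
    assert (Huv' : u' <= v') by (unfold L in Huv; nra).
    specialize (Hs i Hi u' v' Hu' Hv' Huv').
    specialize (Hmono u' v' Hu' Hv' Huv'); simpl in Hmono.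
    assert (HL : L N x i v' - L N x i u' = a N x i * (v' - u'))
      by (unfold L; ring).
    (* The bound for [K] is scaled by [alpha i <= kappa * a N x i]. Since [L N x i] shrinks lengths
       by [a N x i], on the image this is the bound for [kappa * K]. *)
    assert (- (alpha i * (K * (v' - u'))) <= alpha i * (s v' - s u')) by nra.
    assert (alpha i * (K * (v' - u')) <= kappa * a N x i * (K * (v' - u')))
      by (apply Rmult_le_compat_r; nra).
    assert (kappa * K * L N x i v'
            = kappa * K * L N x i u' + kappa * a N x i * (K * (v' - u')))
      by (rewrite <- (Rplus_minus (L N x i u') (L N x i v')), HL; ring).
    lra. }
  pose proof nodes_endpoints_lt as Hlt.
  destruct (C1_add_linear_nondecreasing (x 1%nat) (x N) s ltac:(lra) HC1)
    as [K [HK Hmono]].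
  assert (Hpow : forall n,
    nondecreasing_on (interval N x) (fun t => s t + kappa ^ n * K * t)).
  { induction n as [|n IH].
    - intros u v Hu Hv Huv; specialize (Hmono u v Hu Hv Huv); simpl in *; lra.
    - intros u v Hu Hv Huv.
      pose proof (pow_le kappa n ltac:(lra)).
      specialize (Himp (kappa ^ n * K) ltac:(nra) IH u v Hu Hv Huv).
      simpl in *; lra. }
  intros u v Hu Hv Huv.
  apply Rnot_lt_le; intros Hlt'.
  (* A drop [e] would satisfy [e <= kappa ^ n * K * (v - u)] for all [n], which fails once
     [kappa ^ n] is small. The [+ 1] keeps the divisor positive when [K * (v - u) = 0]. *)
  set (e := s u - s v); assert (He : 0 < e) by (unfold e; lra).
  assert (Hden : 0 < K * (v - u) + 1) by nra.
  destruct (pow_lt_1_zero kappa ltac:(rewrite Rabs_pos_eq; lra)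
              (e / (K * (v - u) + 1)) ltac:(apply Rdiv_lt_0_compat; lra))
    as [n Hn].
  specialize (Hn n (Nat.le_refl n)).
  pose proof (pow_le kappa n ltac:(lra)) as Hp.
  rewrite Rabs_pos_eq in Hn by exact Hp.
  assert (Hq : e / (K * (v - u) + 1) * (K * (v - u) + 1) = e) by (field; lra).
  specialize (Hpow n u v Hu Hv Huv); simpl in Hpow.
  set (q := e / (K * (v - u) + 1)) in *.
  assert (e <= kappa ^ n * (K * (v - u))) by (unfold e; lra).
  nra.
Qed.

End Partition.

(** * Rational cubic Hermite pieces *)

(** [hermite_num Y0 Y1 D0 D1 r t / (1 + (r - 3) t (1 - t))] takes the values
    [Y0], [Y1] and the derivatives [D0], [D1] at [0], [1]. *)
Definition hermite_num (Y0 Y1 D0 D1 r t : R) : R :=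
  Y0 * (1 - t) ^ 3 + (r * Y0 + D0) * t * (1 - t) ^ 2
  + (r * Y1 - D1) * t ^ 2 * (1 - t) + Y1 * t ^ 3.

(** Since [1 - 4 t (1 - t) = (1 - 2 t)^2], the denominator is a square plus [(r + 1) t (1 - t)], and
    the latter is positive inside the interval. *)
Lemma hermite_den_pos (r t : R) :
  -1 < r -> 0 <= t <= 1 -> 0 < 1 + (r - 3) * t * (1 - t).
Proof.
  intros Hr Ht.
  replace (1 + (r - 3) * t * (1 - t))
    with ((1 - 2 * t) ^ 2 + (r + 1) * (t * (1 - t))) by ring.
  destruct (Req_dec t 0) as [->|H0]; [lra|].
  destruct (Req_dec t 1) as [->|H1]; [lra|].
  assert (0 < t * (1 - t)) by (apply Rmult_lt_0_compat; lra).
  pose proof (pow2_ge_0 (1 - 2 * t)); nra.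
Qed.

(* The cross difference is [v - u] times a polynomial of bidegree (2, 2) in
   Bernstein form with nonnegative coefficients; on the diagonal [u = v] it is
   the numerator of the derivative. *)
Lemma hermite_nondecreasing (Y0 Y1 D0 D1 r : R) :
  -1 < r -> 0 <= D0 -> 0 <= D1 -> 0 < Y1 - Y0 -> D0 + D1 <= r * (Y1 - Y0) ->
  nondecreasing_on (fun t => 0 <= t <= 1)
    (fun t => hermite_num Y0 Y1 D0 D1 r t / (1 + (r - 3) * t * (1 - t))).
Proof.
  intros Hr H0 H1 HY Hc u v Hu Hv Huv.
  pose proof (hermite_den_pos r u Hr Hu) as Hdu.
  pose proof (hermite_den_pos r v Hr Hv) as Hdv.
  assert (Hr0 : 0 <= r) by nra.
  assert (E : hermite_num Y0 Y1 D0 D1 r v * (1 + (r - 3) * u * (1 - u))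
              - hermite_num Y0 Y1 D0 D1 r u * (1 + (r - 3) * v * (1 - v))
    = (v - u) *
      (D0 * ((1 - u) ^ 2 * (1 - v) ^ 2)
       + (r * (Y1 - Y0) - D1)
         * ((1 - u) * (1 - v) * (v * (1 - u) + u * (1 - v)))
       + (Y1 - Y0) * ((1 - u) ^ 2 * v ^ 2 + u ^ 2 * (1 - v) ^ 2)
       + (Y1 - Y0 + r * (r * (Y1 - Y0) - D0 - D1))
         * (u * (1 - u) * (v * (1 - v)))
       + (r * (Y1 - Y0) - D0) * (u * v * (v * (1 - u) + u * (1 - v)))
       + D1 * (u ^ 2 * v ^ 2)))
    by (unfold hermite_num; ring).
  apply Rminus_le_0.
  replace (_ / _ - _ / _) with
    ((hermite_num Y0 Y1 D0 D1 r v * (1 + (r - 3) * u * (1 - u))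
      - hermite_num Y0 Y1 D0 D1 r u * (1 + (r - 3) * v * (1 - v)))
     / ((1 + (r - 3) * u * (1 - u)) * (1 + (r - 3) * v * (1 - v))))
    by (field; split; lra).
  apply Rdiv_le_0_compat; [rewrite E | apply Rmult_lt_0_compat; assumption].
  (* This handles the coefficient that is quadratic in [r]; the signs of the others are linear
     consequences of the hypotheses. *)
  assert (Hm : 0 <= r * (r * (Y1 - Y0) - D0 - D1))
    by (apply Rmult_le_pos; lra).
  repeat first
    [ lra
    | apply pow2_ge_0
    | apply Rplus_le_le_0_compat
    | apply Rmult_le_pos ].
Qed.

(** The Hermite data are the prescribed end values and [theta]-derivatives of [S o L_i - alpha_i S];
    the chain rule produces the factors [h x i] and [x N - x 1]. Here [Y1 - Y0] is [shape_den]. *)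
Lemma P_eq_hermite_num (N : nat) (x y d alpha r : nat -> R) (i : nat) (t : R) :
  P N x y d alpha r i t =
  hermite_num (y i - alpha i * y 1%nat) (y (i + 1)%nat - alpha i * y N)
    (h x i * d i - alpha i * (d 1%nat * (x N - x 1%nat)))
    (h x i * d (i + 1)%nat - alpha i * (d N * (x N - x 1%nat))) (r i) t.
Proof. unfold P, hermite_num; ring. Qed.

Lemma slope_mul_h (x y : nat -> R) (i : nat) :
  h x i <> 0 -> h x i * slope x y i = y (i + 1)%nat - y i.
Proof. intros H; unfold slope; field; exact H. Qed.

Lemma slope_eq_0 (x y : nat -> R) (i : nat) :
  h x i <> 0 -> slope x y i = 0 -> y i = y (i + 1)%nat.
Proof.
  intros H E; pose proof (slope_mul_h x y i H) as E'; rewrite E in E'; lra.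
Qed.

(** In the flat case the numerator collapses to [y i * Q r i t]. *)
Lemma flat_ratio (N : nat) (x y d alpha r : nat -> R) (i : nat) (t : R) :
  y i = y (i + 1)%nat -> alpha i = 0 -> d i = 0 -> d (i + 1)%nat = 0 ->
  -1 < r i -> 0 <= t <= 1 ->
  P N x y d alpha r i t / Q r i t = y i.
Proof.
  intros Hy Ha H0 H1 Hr Ht; pose proof (hermite_den_pos (r i) t Hr Ht).
  unfold P, Q; rewrite Ha, H0, H1, <- Hy; field; lra.
Qed.

(** In Hermite terms the [t ^ 3] coefficient of [P] is [D0 + D1 - (r - 1) (Y1 - Y0)], and this [r i]
    is the value that cancels it. Both hatted polynomials are then [slope x y i] times the original
    ones. *)
Lemma quadratic_ratio (N : nat) (x y d alpha r : nat -> R) (i : nat) (t : R) :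
  x N - x 1%nat <> 0 -> h x i <> 0 ->
  slope x y i <> 0 -> shape_den N x y alpha i <> 0 ->
  r i = 1 + shape_quotient N x y d alpha i ->
  -1 < r i -> 0 <= t <= 1 ->
  P N x y d alpha r i t / Q r i t =
  Phat N x y d alpha i t / Qhat N x y d alpha i t.
Proof.
  intros Hl Hh Hs Hden Hr Hr1 Ht.
  pose proof (hermite_den_pos (r i) t Hr1 Ht) as HQ.
  pose proof (slope_mul_h x y i Hh) as Eh.
  assert (EP : Phat N x y d alpha i t = slope x y i * P N x y d alpha r i t).
  { unfold P; rewrite Hr; unfold shape_quotient, Phat, beta.
    unfold shape_den in *; rewrite Eh in *.
    unfold a; field; auto. }
  assert (EQ : Qhat N x y d alpha i t = slope x y i * Q r i t).
  { unfold Q; rewrite Hr; unfold shape_quotient, Qhat, beta.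
    unfold shape_den in *; rewrite Eh in *.
    unfold a; field; auto. }
  rewrite EP, EQ; field; split; [unfold Q; lra | exact Hs].
Qed.

(** * Sign conditions extracted from the scaling condition *)

Lemma scaling_bounds (N : nat) (x y d alpha : nat -> R) (kappa kappa_star : R) :
  scaling_condition N x y d alpha kappa kappa_star ->
  forall i, (1 <= i < N)%nat ->
    0 <= alpha i <= kappa * a N x i /\
    (d 1%nat <> 0 -> alpha i <= d i * a N x i / d 1%nat) /\
    (d N <> 0 -> alpha i <= d (i + 1)%nat * a N x i / d N) /\
    alpha i <= kappa_star * (slope x y i * h x i / (y N - y 1%nat)).
Proof.
  intros H i Hi; destruct (H i Hi) as [H0 Hmin].
  assert (Hin : forall b, In b _ -> alpha i <= b)
    by (intros b Hb; eapply Rle_trans;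
        [exact Hmin | apply MinRlist_P1, Hb]).
  unfold quotient_term in Hin.
  repeat split; intros; auto; apply Hin; rewrite !in_app_iff; simpl; auto;
    repeat destruct Req_dec_T; simpl; tauto.
Qed.

(** The last term of the minimum gives [alpha_i (y_N - y_1) <= kappa_star (y_{i+1} - y_i)], and the
    right side is less than [y_{i+1} - y_i] because the piece is not flat. *)
Lemma shape_den_pos (N : nat) (x y d alpha : nat -> R) (kappa kappa_star : R) :
  (2 <= N)%nat -> (forall i, (1 <= i < N)%nat -> x i < x (i + 1)%nat) ->
  kappa_star < 1 -> increasing_data N y ->
  scaling_condition N x y d alpha kappa kappa_star ->
  forall i, (1 <= i < N)%nat -> slope x y i <> 0 ->
    0 < shape_den N x y alpha i.
Proof.
  intros HN Hx Hks Hy Hsc i Hi Hs.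
  pose proof (h_pos N x Hx i Hi) as Hh.
  pose proof (slope_mul_h x y i ltac:(lra)) as E.
  destruct (scaling_bounds _ _ _ _ _ _ _ Hsc i Hi) as [_ [_ [_ Hb]]].
  assert (Hd : 0 < y (i + 1)%nat - y i).
  { destruct (Hy i Hi) as [Hlt|Heq]; [lra|].
    exfalso; apply Hs; unfold slope; rewrite Heq; field; lra. }
  pose proof (sequence_nondecreasing N y Hy 1 i ltac:(lia) ltac:(lia)).
  pose proof (sequence_nondecreasing N y Hy (i + 1) N ltac:(lia) ltac:(lia)).
  (* The total rise contains the strict rise of this piece, so the division in [Hb] is a genuine
     one. *)
  assert (HyN : 0 < y N - y 1%nat) by lra.
  rewrite Rmult_comm with (r1 := slope x y i), E in Hb.
  apply Rmult_le_compat_r with (r := y N - y 1%nat) in Hb; [|lra].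
  replace (kappa_star * ((y (i + 1)%nat - y i) / (y N - y 1%nat))
           * (y N - y 1%nat))
    with (kappa_star * (y (i + 1)%nat - y i)) in Hb by (field; lra).
  unfold shape_den; rewrite E; nra.
Qed.

(** Serves for both end derivatives of a piece, with [de] standing for [d 1] or [d N]. When [de = 0]
    its term is omitted from the minimum, but the subtracted product vanishes too. *)
Lemma end_derivative_nonneg (l ai al di de : R) :
  0 < l -> 0 <= ai -> 0 <= di -> 0 <= de ->
  (de <> 0 -> al <= di * ai / de) ->
  0 <= ai * l * di - al * (de * l).
Proof.
  intros Hl Ha Hdi Hde H.
  destruct (Req_dec de 0) as [->|Hn]; [assert (0 <= ai * di) by nra; nra|].
  specialize (H Hn).
  apply Rmult_le_compat_r with (r := de) in H; [|lra].
  replace (di * ai / de * de) with (di * ai) in H by (field; lra).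
  nra.
Qed.

(** * Monotonicity for increasing data *)

Lemma FIF_nondecreasing
    (N : nat) (x y d alpha r : nat -> R) (kappa kappa_star : R) (s : R -> R) :
  (2 <= N)%nat -> (forall i, (1 <= i < N)%nat -> x i < x (i + 1)%nat) ->
  0 <= kappa < 1 -> kappa_star < 1 ->
  (forall i, (1 <= i < N)%nat -> -1 < r i) ->
  flat_convention N x y d alpha ->
  rational_cubic_FIF N x y d alpha r s ->
  increasing_data N y ->
  (forall i, (1 <= i <= N)%nat -> 0 <= d i) ->
  scaling_condition N x y d alpha kappa kappa_star ->
  shape_condition N x y d alpha r ->
  nondecreasing_on (interval N x) s.
Proof.
  intros HN Hx Hk Hks Hr Hflat [HC1 Heq] Hy Hd Hsc Hsh.
  pose proof (scaling_bounds _ _ _ _ _ _ _ Hsc) as Hb.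
  apply self_similar_nondecreasing with alpha kappa; auto.
  { intros i Hi; apply Hb, Hi. }
  intros i Hi u v Hu Hv Huv.
  rewrite (Heq i Hi u Hu), (Heq i Hi v Hv).
  pose proof (theta_in N x HN Hx u Hu) as Htu.
  pose proof (theta_in N x HN Hx v Hv) as Htv.
  pose proof (theta_le N x HN Hx u v Huv) as Htuv.
  pose proof (h_pos N x Hx i Hi) as Hh.
  enough (P N x y d alpha r i (theta N x u) / Q r i (theta N x u)
          <= P N x y d alpha r i (theta N x v) / Q r i (theta N x v)) by lra.
  destruct (Req_dec (slope x y i) 0) as [E|Hs].
  { destruct (Hflat i Hi E) as [E1 [E2 E3]].
    pose proof (slope_eq_0 x y i ltac:(lra) E) as E4.
    rewrite !flat_ratio by auto; lra. }
  pose proof (shape_den_pos _ _ _ _ _ _ _ HN Hx Hks Hy Hsc i Hi Hs) as Hpos.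
  specialize (Hsh i Hi Hs); specialize (Hr i Hi).
  destruct (Hb i Hi) as [_ [Hb1 [HbN _]]].
  pose proof (nodes_endpoints_lt N x HN Hx).
  pose proof (a_pos N x HN Hx i Hi).
  apply Rge_le in Hsh; unfold shape_quotient in Hsh.
  (* Cleared of its positive denominator, the shape condition becomes the requirement
     [D0 + D1 <= r (Y1 - Y0)] of [hermite_nondecreasing]. *)
  apply Rmult_le_compat_r with (r := shape_den N x y alpha i) in Hsh; [|lra].
  unfold Rdiv in Hsh; rewrite Rmult_assoc, Rinv_l, Rmult_1_r in Hsh by lra.
  unfold shape_den in *; rewrite slope_mul_h in * by lra.
  rewrite !P_eq_hermite_num; unfold Q.
  apply (hermite_nondecreasing _ _ _ _ (r i)); auto; try lra.
  - rewrite (h_eq N x HN Hx i).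
    apply end_derivative_nonneg; auto; try lra; apply Hd; lia.
  - rewrite (h_eq N x HN Hx i).
    apply end_derivative_nonneg; auto; try lra; apply Hd; lia.
Qed.

(** * Decreasing data by negation *)

Definition opp_seq (y : nat -> R) (i : nat) : R := - y i.

Lemma slope_opp (x y : nat -> R) (i : nat) :
  slope x (opp_seq y) i = - slope x y i.
Proof. unfold slope, opp_seq, Rdiv; ring. Qed.

Lemma shape_den_opp (N : nat) (x y alpha : nat -> R) (i : nat) :
  shape_den N x (opp_seq y) alpha i = - shape_den N x y alpha i.
Proof. unfold shape_den; rewrite slope_opp; unfold opp_seq; ring. Qed.

Lemma quotient_opp (num den : R) : - num / - den = num / den.
Proof. unfold Rdiv; rewrite Rinv_opp; ring. Qed.

Lemma quotient_term_opp (num den : R) :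
  quotient_term (- num) (- den) = quotient_term num den.
Proof.
  unfold quotient_term; rewrite quotient_opp.
  destruct (Req_dec_T (- den) 0), (Req_dec_T den 0); auto; exfalso; lra.
Qed.

Lemma flat_convention_opp (N : nat) (x y d alpha : nat -> R) :
  flat_convention N x y d alpha ->
  flat_convention N x (opp_seq y) (opp_seq d) alpha.
Proof.
  intros H i Hi E; rewrite slope_opp in E.
  destruct (H i Hi ltac:(lra)) as [E1 [E2 E3]]; unfold opp_seq; lra.
Qed.

(** Numerator and denominator of each quotient in the minimum change sign together, and
    [kappa * a N x i] involves neither [y] nor [d]; the same [alpha] therefore serves. *)
Lemma scaling_condition_opp
    (N : nat) (x y d alpha : nat -> R) (kappa kappa_star : R) :
  scaling_condition N x y d alpha kappa kappa_star ->
  scaling_condition N x (opp_seq y) (opp_seq d) alpha kappa kappa_star.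
Proof.
  intros H i Hi; specialize (H i Hi).
  rewrite slope_opp; unfold opp_seq.
  rewrite <- !Ropp_mult_distr_l, !quotient_term_opp.
  replace (- y N - - y 1%nat) with (- (y N - y 1%nat)) by ring.
  rewrite quotient_opp; exact H.
Qed.

Lemma shape_condition_opp (N : nat) (x y d alpha r : nat -> R) :
  shape_condition N x y d alpha r ->
  shape_condition N x (opp_seq y) (opp_seq d) alpha r.
Proof.
  intros H i Hi Hs; rewrite slope_opp in Hs; specialize (H i Hi ltac:(lra)).
  unfold shape_quotient in *; rewrite shape_den_opp, <- quotient_opp, Ropp_involutive.
  replace (- _) with (h x i * (d i + d (i + 1)%nat)
    - alpha i * (x N - x 1%nat) * (d 1%nat + d N)) by (unfold opp_seq; ring).
  exact H.
Qed.

Lemma C1_on_opp (D : R -> Prop) (f : R -> R) :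
  C1_on D f -> C1_on D (fun t => - f t).
Proof.
  intros [f' H]; exists (fun t => - f' t); intros t Ht.
  destruct (H t Ht) as [H1 H2]; split.
  - apply Dopp, H1.
  - apply limit_Ropp, H2.
Qed.

(** [P] is jointly linear in [y] and [d], while [Q] depends on neither. *)
Lemma rational_cubic_FIF_opp
    (N : nat) (x y d alpha r : nat -> R) (s : R -> R) :
  rational_cubic_FIF N x y d alpha r s ->
  rational_cubic_FIF N x (opp_seq y) (opp_seq d) alpha r (fun t => - s t).
Proof.
  intros [HC1 H]; split; [apply C1_on_opp, HC1|].
  intros i Hi t Ht; rewrite (H i Hi t Ht).
  unfold P, opp_seq, Rdiv; ring.
Qed.

Lemma FIF_monotonic_as_data
    (N : nat) (x y d alpha r : nat -> R) (kappa kappa_star : R) (s : R -> R) :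
  (2 <= N)%nat -> (forall i, (1 <= i < N)%nat -> x i < x (i + 1)%nat) ->
  0 <= kappa < 1 -> kappa_star < 1 ->
  (forall i, (1 <= i < N)%nat -> -1 < r i) ->
  flat_convention N x y d alpha ->
  rational_cubic_FIF N x y d alpha r s ->
  (increasing_data N y -> forall i, (1 <= i <= N)%nat -> 0 <= d i) ->
  (decreasing_data N y -> forall i, (1 <= i <= N)%nat -> d i <= 0) ->
  scaling_condition N x y d alpha kappa kappa_star ->
  shape_condition N x y d alpha r ->
  monotonic_as_data N x y s.
Proof.
  intros HN Hx Hk Hks Hr Hflat Hs Hincr Hdecr Hsc Hsh; split; intros Hy.
  - apply (FIF_nondecreasing N x y d alpha r kappa kappa_star); auto.
  - enough (H : nondecreasing_on (interval N x) (fun t => - s t))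
      by (intros u v Hu Hv Huv; specialize (H u v Hu Hv Huv); simpl in H; lra).
    apply (FIF_nondecreasing N x (opp_seq y) (opp_seq d) alpha r
             kappa kappa_star);
      auto using flat_convention_opp, rational_cubic_FIF_opp,
        scaling_condition_opp, shape_condition_opp.
    + intros i Hi; specialize (Hy i Hi); unfold opp_seq; lra.
    + intros i Hi; specialize (Hdecr Hy i Hi); unfold opp_seq; lra.
Qed.

(** * The rational quadratic case and the full statement *)

Lemma FIF_rational_quadratic
    (N : nat) (x y d alpha r : nat -> R) (s : R -> R) :
  (2 <= N)%nat -> (forall i, (1 <= i < N)%nat -> x i < x (i + 1)%nat) ->
  (forall i, (1 <= i < N)%nat -> -1 < r i) ->
  flat_convention N x y d alpha ->
  rational_cubic_FIF N x y d alpha r s ->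
  quadratic_shape N x y d alpha r ->
  (forall i, (1 <= i < N)%nat -> slope x y i <> 0 ->
     shape_den N x y alpha i <> 0) ->
  rational_quadratic_form N x y d alpha s.
Proof.
  intros HN Hx Hr Hflat [_ Heq] Hq Hden i Hi t Ht.
  pose proof (h_pos N x Hx i Hi) as Hh.
  pose proof (nodes_endpoints_lt N x HN Hx).
  pose proof (theta_in N x HN Hx t Ht) as Htt.
  rewrite (Heq i Hi t Ht); split; intros Hs.
  - f_equal; apply quadratic_ratio; auto; lra.
  - destruct (Hflat i Hi Hs) as [E1 [E2 E3]].
    pose proof (slope_eq_0 x y i ltac:(lra) Hs) as E4.
    rewrite flat_ratio by auto; rewrite E1; split; [ring | exact E4].
Qed.

(** The denominator is positive for increasing data and, by negation, negative for decreasing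
    data. *)
Lemma scaling_shape_den_neq_0
    (N : nat) (x y d alpha : nat -> R) (kappa kappa_star : R) :
  (2 <= N)%nat -> (forall i, (1 <= i < N)%nat -> x i < x (i + 1)%nat) ->
  kappa_star < 1 -> increasing_data N y \/ decreasing_data N y ->
  scaling_condition N x y d alpha kappa kappa_star ->
  forall i, (1 <= i < N)%nat -> slope x y i <> 0 ->
    shape_den N x y alpha i <> 0.
Proof.
  intros HN Hx Hks [Hy|Hy] Hsc i Hi Hs.
  - pose proof (shape_den_pos _ _ _ _ _ _ _ HN Hx Hks Hy Hsc i Hi Hs); lra.
  - pose proof (shape_den_pos N x (opp_seq y) (opp_seq d) alpha kappa kappa_star
                  HN Hx Hks) as H.
    rewrite <- (Ropp_involutive (shape_den _ _ _ _ _)), <- shape_den_opp.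
    enough (0 < shape_den N x (opp_seq y) alpha i) by lra.
    apply H; auto using scaling_condition_opp.
    + intros j Hj; specialize (Hy j Hj); unfold opp_seq; lra.
    + rewrite slope_opp; lra.
Qed.

(** The reduction to the quadratic form is asserted whenever the quotients defining [r] have nonzero
    denominators; the scaling condition then guarantees this. *)
Theorem theorem4p1
    (N : nat) (x y d alpha r : nat -> R) (kappa kappa_star : R) (s : R -> R)
    (hN : (2 <= N)%nat)
    (hx : forall i, (1 <= i < N)%nat -> x i < x (i + 1)%nat)
    (hkappa : 0 <= kappa < 1)
    (hkappa_star : 0 <= kappa_star < 1)
    (halpha : forall i, (1 <= i < N)%nat -> Rabs (alpha i) <= kappa * a N x i)
    (hr : forall i, (1 <= i < N)%nat -> -1 < r i)
    (hflat : flat_convention N x y d alpha)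
    (hs : rational_cubic_FIF N x y d alpha r s)
    (hy : increasing_data N y \/ decreasing_data N y)
    (hd_incr : increasing_data N y ->
               forall i, (1 <= i <= N)%nat -> 0 <= d i)
    (hd_decr : decreasing_data N y ->
               forall i, (1 <= i <= N)%nat -> d i <= 0) :
  (scaling_condition N x y d alpha kappa kappa_star ->
   shape_condition N x y d alpha r ->
   monotonic_as_data N x y s) /\
  (quadratic_shape N x y d alpha r ->
   ((forall i, (1 <= i < N)%nat -> slope x y i <> 0 ->
       shape_den N x y alpha i <> 0) ->
    rational_quadratic_form N x y d alpha s) /\
   (scaling_condition N x y d alpha kappa kappa_star ->
    rational_quadratic_form N x y d alpha s /\
    monotonic_as_data N x y s)).
Proof.
  assert (Hmono : scaling_condition N x y d alpha kappa kappa_star ->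
                  shape_condition N x y d alpha r -> monotonic_as_data N x y s)
    by (apply FIF_monotonic_as_data; auto; lra).
  split; [exact Hmono|].
  intros Hq; split.
  - apply FIF_rational_quadratic with r; auto.
  - intros Hsc; split.
    + apply FIF_rational_quadratic with r; auto.
      apply (scaling_shape_den_neq_0 N x y d alpha kappa kappa_star); auto; lra.
    + apply Hmono; [exact Hsc|].
      (* The special [r i] exceeds the bound of the shape condition by exactly 1. *)
      intros i Hi Hs; rewrite (Hq i Hi Hs); lra.
Qed.
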